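(* Let $q$ be a power of a prime, $m$ a prime divisor of $q-1$, $k=\mathbb{F}_q(t)$, $A=\mathbb{F}_q[t]$, and $S=\{D_1,\dots,D_l\}$ a finite set of nonconstant polynomials in $A$ such that $K=k(\sqrt[m]{D_1},\dots,\sqrt[m]{D_l})$ is a geometric extension of $k$ (its full constant field is $\mathbb{F}_q$). Let $\gamma_S$ be the cardinality of $$\{(a_1,\dots,a_l)\in\{0,1,\dots,m-1\}^l \mid D_1^{a_1}\cdots D_l^{a_l}=F^m \text{ for some } F\in A\}.$$ Let $\mathscr{M}$ be the set of monic irreducible $P\in A$ with $(D_1/P)_m=\cdots=(D_l/P)_m=1$. Then the relative density of $\mathscr{M}$ exists and equals $\gamma_S/m^l$.
   Context: For a monic irreducible $P\in A$ and $a\in A$ with $P\nmid a$, $(a/P)_m$ is the unique element of $\mathbb{F}_q^*$ with $a^{(q^{\deg P}-1)/m}\equiv (a/P)_m\pmod P$; if $P\mid a$, $(a/P)_m=0$. A set $T$ of monic irreducible polynomials has relative density $\varepsilon$ if $\lim_{N\to\infty}\#\{P\in T:\deg P=N\}/\pi(N)=\varepsilon$, where $\pi(N)$ is the number of monic irreducible polynomials of degree $N$ in $A$. *)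

(* Defs.v *)
From mathcomp Require Import all_boot all_order all_algebra all_field.
From mathcomp Require Import all_classical all_reals all_analysis.

Set Implicit Arguments.
Unset Strict Implicit.
Unset Printing Implicit Defensive.

Import Order.TTheory GRing.Theory Num.Theory.
Import numFieldNormedType.Exports.

Local Open Scope classical_set_scope.
Local Open Scope ring_scope.

Definition constant_embedding (F : finFieldType)
    (L : fieldExtType {fraction {poly F}}) (c : F) : L :=
  (FracField.tofrac c%:P)%:A.

Definition geometric_extension (F : finFieldType)
    (L : fieldExtType {fraction {poly F}}) : Prop :=
  forall x : L, algebraicOver (@constant_embedding F L) x ->
    exists c : F, x = constant_embedding L c.

(* Meant for P monic irreducible and m dividing #|F| - 1; the value picked is
   then unique, by residue_symbolP below. The degree of P is (size P).-1. *)
Definition residue_symbol (F : finFieldType) (m : nat) (a P : {poly F}) : F :=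
  if P %| a then 0 else
  odflt 0 [pick c : F | (c != 0) &&
    (P %| a ^+ (((#|F| ^ (size P).-1) - 1) %/ m)%N - c%:P)].

Lemma dvdp_in_qpoly (F : finFieldType) (P u : {poly F}) :
  (1 < size P)%N -> P \is monic -> (P %| u) = (in_qpoly P u == 0).
Proof.
move=> sP mP; rewrite -val_eqE /= /mk_monic sP mP /=.
by rewrite Pdiv.Idomain.dvdpE.
Qed.

Lemma dvdp_bigprod (F : finFieldType) (P : {poly F}) (I : Type) (s : seq I)
    (f : I -> {poly F}) :
  irreducible_poly P -> P %| \prod_(i <- s) f i -> has (fun i => P %| f i) s.
Proof.
move=> iP; elim: s => [|i s IHs] /=.
  by rewrite big_nil dvdp1; case: iP => sP _; rewrite gtn_eqF.
rewrite big_cons; have [//|nPi /=] := boolP (P %| f i).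
by rewrite Gauss_dvdpr // irreducible_poly_coprime.
Qed.

Lemma residue_symbolP (F : finFieldType) (m : nat) (a P : {poly F}) (c : F) :
    (m %| #|F| - 1)%N -> P \is monic -> irreducible_poly P -> ~~ (P %| a) ->
  c = residue_symbol m a P <->
    c != 0 /\ P %| a ^+ (((#|F| ^ (size P).-1) - 1) %/ m)%N - c%:P.
Proof.
move=> mF mP iP nPa; have sP : (1 < size P)%N by case: iP.
set n := (#|F| ^ _)%N; set e := (_ %/ m)%N; set b := a ^+ e.
have q1 : (1 < #|F|)%N := finNzRing_gt1 F.
have uniqc (c1 c2 : F) : P %| b - c1%:P -> P %| b - c2%:P -> c1 = c2.
  move=> h1 h2; apply/eqP; rewrite -subr_eq0.
  have : P %| (c1 - c2)%:P.
    have -> : (c1 - c2)%:P = (b - c2%:P) - (b - c1%:P).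
      by rewrite polyCB opprB [RHS]addrC addrA subrK.
    by rewrite dvdp_sub.
  have [//|nz] := eqVneq (c1 - c2) 0.
  move/dvdp_leq; rewrite polyC_eq0 nz size_polyC nz => /(_ isT).
  by rewrite leqNgt sP.
have nPb : ~~ (P %| b).
  rewrite /b; elim: (e) => [|k IHk]; first by rewrite dvdp1 gtn_eqF.
  by rewrite exprS Gauss_dvdpr // irreducible_poly_coprime.
have dn : P %| a ^+ (n - 1) - 1.
  have hI : monic_irreducible_poly P by split.
  have cardQ : #|{poly %/ P with hI}| = n := card_monic_qpoly sP mP.
  pose pi := in_qpoly P : {poly F} -> {poly %/ P}.
  have : pi (a ^+ n - a) == 0.
    rewrite /pi rmorphB rmorphXn /= subr_eq0 -cardQ; apply/eqP.
    exact: (@expf_card {poly %/ P with hI} (in_qpoly P a)).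
  rewrite -dvdp_in_qpoly //.
  have n0 : (0 < n)%N by rewrite expn_gt0 (ltnW q1).
  have -> : a ^+ n - a = a * (a ^+ (n - 1) - 1).
    by rewrite mulrBr mulr1 -exprS subn1 prednK.
  by rewrite Gauss_dvdpr // irreducible_poly_coprime.
have en : (e * m = n - 1)%N.
  apply: divnK; apply: dvdn_trans mF _.
  by rewrite /n !subn1 dvdn_pred_predX.
have Pbq : P %| b ^+ #|F| - b.
  have -> : b ^+ #|F| - b = b * (b ^+ (#|F| - 1) - 1).
    by rewrite mulrBr mulr1 -exprS subn1 prednK // ltnW.
  apply: dvdp_mull; case/dvdnP: mF => k ->.
  rewrite /b -exprM mulnCA en exprM exprAC.
  have -> : forall x : {poly F}, x ^+ k - 1 = x ^+ k - 1 ^+ k.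
    by move=> x; rewrite expr1n.
  by rewrite subrXX dvdp_mulr.
have [c0 Pc0] : exists c0 : F, P %| b - c0%:P.
  have /(congr1 (fun p : {poly F} => (map_poly polyC p).[b])) :=
    finField_genPoly F.
  rewrite rmorphB /= map_polyXn map_polyX hornerD hornerN hornerXn hornerX.
  rewrite rmorph_prod horner_prod => Eb; move: Pbq; rewrite Eb.
  case/(dvdp_bigprod iP)/hasP=> c0 _.
  by rewrite rmorphB /= map_polyX map_polyC /= hornerXsubC => h; exists c0.
have c0n : c0 != 0.
  by apply: contra nPb => /eqP c00; rewrite c00 subr0 in Pc0.
rewrite /residue_symbol (negbTE nPa) -/n -/e -/b.
case: pickP => [c1 /andP[c1n Pc1] /=|/(_ c0)]; last by rewrite c0n Pc0.
split=> [->//|[_ Pc]]; exact: uniqc Pc Pc1.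
Qed.

Definition monic_irreducible (F : finFieldType) : set {poly F} :=
  [set P | P \is monic /\ irreducible_poly P].

(* {poly_N.+1 F} is the finite type of polynomials of degree at most N. *)
Definition count_degree (F : finFieldType) (T : set {poly F}) (N : nat) : nat :=
  #|[set P : {poly_N.+1 F} | (size P == N.+1) && `[< T P >]]%SET|.

Definition has_relative_density (R : realType) (F : finFieldType)
    (T : set {poly F}) (eps : R) : Prop :=
  (fun N : nat => (count_degree T N)%:R / (count_degree (@monic_irreducible F) N)%:R : R)
    @ \oo --> eps.

Definition gamma_set (F : finFieldType) (m l : nat) (D : 'I_l -> {poly F}) : nat :=
  #|[set a : {ffun 'I_l -> 'I_m} |
      `[< exists G : {poly F}, \prod_(i < l) D i ^+ a i = G ^+ m >]]%SET|.

Definition split_primes (F : finFieldType) (m l : nat) (D : 'I_l -> {poly F}) :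
    set {poly F} :=
  [set P | monic_irreducible P /\ forall i, residue_symbol m (D i) P = 1].

(* Main.v *)
(* For E in F_q[t] not of the form c G^m, the residues (E/P)_m of the primes P of degree N
   are equidistributed in the m-th roots of unity as N grows. This is Stepanov's method.
   With Q = q^N and n = (Q - 1)/m, the roots z of the P with (E/P)_m = c, in an algebraic
   closure, satisfy z^Q = z and E(z)^n = c. Linear algebra gives a nonzero polynomial
   h = sum_(i < m, j <= t) E^(M + n i) r_ij (X - x)^(j Q), with M = m t and all r_ij of degree
   below about Q/m, that vanishes to order M at all these points: a Hasse derivative of order
   k < M treats (X - x)^(j Q) as a constant and costs k factors E, and at such a z the factors
   E^n and X^Q become c and X, which leaves conditions of low degree. That h is nonzero is read
   off the multiplicity at a root x of E whose multiplicity is prime to m. Comparing degrees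
   bounds the number of primes of residue c by (1/m + o(1)) Q/N for each c; since the total is
   (1 + o(1)) Q/N, each bound is sharp.

   Being geometric, K contains no m-th root of a constant outside F_q, so a product D^a is
   either an m-th power or not of the form c G^m, and (D^a/P)_m = 1 holds with density 1 or
   1/m. Finally, for a fixed P, the number of exponent vectors a with (D^a/P)_m = 1 is m^l if P
   splits and m^(l-1) otherwise; summing over P of degree N gives the density. *)
From HB Require Import structures.
Require Import Defs.
From mathcomp Require Import all_boot all_order all_algebra all_field.
From mathcomp Require Import all_classical all_reals all_analysis.
From mathcomp Require Import zify ring lra.

Set Implicit Arguments.
Unset Strict Implicit.
Unset Printing Implicit Defensive.

Import Order.TTheory GRing.Theory Num.Theory.
Import numFieldNormedType.Exports.
Local Open Scope ring_scope.

(** * Hasse derivatives *)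

(** Taylor's formula, with the inner indeterminate as base point and the outer one as increment.
    Hasse derivatives become coefficients of the image of [u] under a ring morphism, so the Leibniz
    and Frobenius rules reduce to products of polynomials. *)
Lemma coef_taylor_shift (R : comNzRingType) (u : {poly R}) (k : nat) :
  ((map_poly (polyC \o polyC) u : {poly {poly {poly R}}}).['X%:P + 'X])`_k
    = u^`N(k).
Proof.
rewrite nderiv_taylor; last exact: mulrC.
rewrite size_map_inj_poly ?rmorph0 //; last by move=> x y /polyC_inj /polyC_inj.
have hor (v : {poly R}) : (map_poly (polyC \o polyC) v).['X%:P] = v%:P :> {poly {poly R}}.
  by rewrite map_poly_comp horner_map /= -[X in _ = X%:P]comp_polyXr.
under eq_bigr => i _ do rewrite nderivn_map hor mul_polyC.
rewrite coef_sum.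
have [lt_k|le_k] := ltnP k (size u); last first.
  rewrite nderivn_poly0 // big1 // => i _; rewrite coefZ coefXn gtn_eqF ?mulr0 //.
  exact: leq_trans (ltn_ord i) le_k.
rewrite (bigD1 (Ordinal lt_k)) //= coefZ coefXn eqxx mulr1 big1 ?addr0 // => i ne_ik.
by rewrite coefZ coefXn eq_sym (negbTE (ne_ik : (i : nat) != k)) mulr0.
Qed.

Lemma nderivnM (R : comNzRingType) (u v : {poly R}) (k : nat) :
  (u * v)^`N(k) = \sum_(i < k.+1) u^`N(i) * v^`N(k - i).
Proof.
rewrite -coef_taylor_shift rmorphM hornerM coefM.
by apply: eq_bigr => i _; rewrite !coef_taylor_shift.
Qed.

Lemma size_nderivn (R : nzSemiRingType) (u : {poly R}) (k : nat) :
  (size u^`N(k) <= size u - k)%N.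
Proof. exact: size_poly. Qed.

(** Peel off one factor [f] by the Leibniz rule: either it stays underived, or it absorbs at least
    one order of derivation and leaves fewer for [f ^+ e]. *)
Lemma dvdp_nderivn_expM (L : fieldType) (f u : {poly L}) (e k : nat) :
  f ^+ (e - k) %| (f ^+ e * u)^`N(k).
Proof.
elim: e k => [|e IHe] k; first by rewrite expr0 dvd1p.
rewrite exprS -mulrA nderivnM; elim/big_ind: _ => [|a b|i _].
- exact: dvdp0.
- exact: dvdp_add.
case: (posnP i) => [->|i_gt0].
  rewrite subn0 nderivn0.
  have [le_ke|lt_ek] := leqP k e.
    by rewrite subSn // exprS dvdp_mul.
  by rewrite (eqP (_ : e.+1 - k == 0)%N) ?expr0 ?dvd1p // subn_eq0.
apply/dvdp_mull; apply: (dvdp_trans _ (IHe (k - i)%N)).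
apply: dvdp_exp2l; have := ltn_ord i; lia.
Qed.

(** Frobenius is additive, so the shift of [w ^+ (p ^ s)] involves only powers of the increment
    whose exponents are multiples of [p ^ s]; for derivatives of lower order this factor is a
    constant. *)
Lemma nderivn_mul_pchar (L : fieldType) (p s : nat) (u w : {poly L}) (k : nat) :
  p \in [pchar L] -> (k < p ^ s)%N ->
  (u * w ^+ (p ^ s))^`N(k) = u^`N(k) * w ^+ (p ^ s).
Proof.
move=> charLp lt_k; set Q := (p ^ s)%N.
have hasse0 (i : nat) : (0 < i < Q)%N -> (w ^+ Q)^`N(i) = 0.
  case/andP=> i_gt0 lt_iQ; rewrite -coef_taylor_shift rmorphXn horner_exp.
  have natQ : [pchar {poly {poly L}}].-nat Q.
    by rewrite pnatX pnatE ?(pcharf_prime charLp) // !pchar_poly charLp.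
  (* Only a case distinction: a polynomial [z * 'X + c%:P] has [Q]-th power
     [z ^+ Q * 'X^Q + (c ^+ Q)%:P], without terms of degree strictly between 0 and [Q]. *)
  elim/poly_ind: (_.[_]) => [|z c _].
    by rewrite expr0n expn_eq0 (gtn_eqF (prime_gt0 (pcharf_prime charLp))) /= coef0.
  rewrite exprDn_pchar // exprMn -rmorphXn coefD coefC gtn_eqF // addr0.
  by rewrite coefMXn lt_iQ.
rewrite nderivnM big_ord_recr /= subnn nderivn0 big1 ?add0r // => i _.
by rewrite hasse0 ?mulr0 // subn_gt0 ltn_ord (leq_ltn_trans (leq_subr _ _)).
Qed.

Lemma dvdp_exp_XsubC_nderivn (L : fieldType) (u : {poly L}) (z : L) (M : nat) :
  (forall k, (k < M)%N -> (u^`N(k)).[z] = 0) -> ('X - z%:P) ^+ M %| u.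
Proof.
move=> u0; have -> : u = (map_poly polyC u).[z%:P + ('X - z%:P)].
  by rewrite addrC subrK -[LHS]comp_polyXr.
rewrite nderiv_taylor; last exact: mulrC.
elim/big_ind: _ => [|a b|i _]; [exact: dvdp0|exact: dvdp_add|].
rewrite nderivn_map horner_map /=.
have [lt_iM|le_Mi] := ltnP i M; first by rewrite u0 // mul0r dvdp0.
exact/dvdp_mull/dvdp_exp2l.
Qed.

Lemma dvdp_prod_exp_XsubC (L : fieldType) (u : {poly L}) (Z : seq L) (M : nat) :
    uniq Z -> (forall z, z \in Z -> ('X - z%:P) ^+ M %| u) ->
  (\prod_(z <- Z) ('X - z%:P)) ^+ M %| u.
Proof.
elim: Z => [|z Z IHZ] /=; first by rewrite big_nil expr1n dvd1p.
case/andP=> zZ uniqZ dvdu; rewrite big_cons exprMn Gauss_dvdp.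
  rewrite dvdu ?mem_head // IHZ // => y yZ; apply: dvdu.
  by rewrite inE yZ orbT.
by rewrite coprimep_expl // coprimep_expr // coprimep_sym coprimep_XsubC root_prod_XsubC.
Qed.

(** If the sum were zero, the nonzero term of least multiplicity at [x] would be minus the sum of
    the others, which vanishes to higher order. *)
Lemma mup_sum_neq0 (L : fieldType) (I : finType) (u : I -> {poly L}) (x : L) (i1 : I) :
    (forall i j, u i != 0 -> u j != 0 -> mup x (u i) = mup x (u j) -> i = j) ->
  u i1 != 0 -> \sum_i u i != 0.
Proof.
move=> inj_mup nz1.
case: (@arg_minnP I i1 (fun i => u i != 0) (fun i => mup x (u i)) nz1) => i nz_i min_i.
apply/eqP => sum0; have : ('X - x%:P) ^+ (mup x (u i)).+1 %| u i.
  have eq_i : u i = - \sum_(j | j != i) u j.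
    by apply/eqP; rewrite -addr_eq0; move: sum0; rewrite (bigD1 i) //= => ->.
  rewrite [X in _ %| X]eq_i dvdpNr; elim/big_ind: _ => [|a b|j ne_ji]; [exact: dvdp0|exact: dvdp_add|].
  have [->|nz_j] := eqVneq (u j) 0; first exact: dvdp0.
  rewrite -mup_geq // ltn_neqAle min_i // andbT.
  by apply: contra ne_ji => /eqP /inj_mup ->.
by rewrite -mup_geq // ltnn.
Qed.

Lemma linear_kernel_neq0 (L : fieldType) (V W : vectType L) (phi : V -> W) :
    linear phi -> (dim W < dim V)%N ->
  exists2 v, v != 0 & phi v = 0.
Proof.
move=> lin_phi lt_dim.
pose psi : {linear V -> W} := HB.pack phi (GRing.isLinear.Build L V W _ phi lin_phi).
have : lker (linfun psi) != 0%VS.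
  rewrite -dimv_eq0; have := limg_ker_dim (linfun psi) fullv.
  rewrite capfv dimvf; have := dimvS (subvf (limg (linfun psi))); rewrite dimvf.
  lia.
rewrite -subv0 => /subvPn[v]; rewrite memv_ker lfunE memv0 => /eqP phi0 nz_v.
by exists v.
Qed.

(** * Stepanov's bound *)

(* The multiplicity at [x] of the term of index [(i, j)] of the auxiliary polynomial
   below has the form on either side of the equation. *)
Lemma stepanov_mup_inj (m n d Q e A : nat) (i i' j j' v v' M : nat) :
    prime m -> ~~ (m %| e)%N -> (m * n).+1 = Q -> (e <= d)%N -> (A + d <= n)%N ->
    (i < m)%N -> (i' < m)%N -> (v < A)%N -> (v' < A)%N ->
    (e * (M + n * i) + v + j * Q = e * (M + n * i') + v' + j' * Q)%N ->
  i = i' /\ j = j'.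
Proof.
move=> m_prime ndvd_me defQ le_ed le_An lt_i lt_i' lt_v lt_v' eq_val.
(* Multiply by [m] and replace [m * n] by [Q - 1]. Both sides are then expansions in base [Q], the
   last digit being below [Q] because [A + d <= n]; comparing leading parts modulo [m] gives
   [i = i']. *)
have eqm : ((e * i + m * j) * Q + m * v + e * i' = (e * i' + m * j') * Q + m * v' + e * i)%N.
  by rewrite -defQ in eq_val *; nia.
have eqw : (e * i + m * j = e * i' + m * j')%N.
  have lt_Q (a b : nat) : (a < m)%N -> (b < A)%N -> (m * b + e * a < Q)%N.
    by move=> lt_a lt_b; rewrite -defQ; nia.
  have h1 := lt_Q i' v lt_i' lt_v; have h2 := lt_Q i v' lt_i lt_v'.
  move: eqm h1 h2; move: (e * i + m * j)%N (e * i' + m * j')%N (m * v)%N (m * v')%N (e * i)%N (e * i')%N; nia.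
have m_gt0 := prime_gt0 m_prime.
have eq_i : i = i'.
  have : (e * i == e * i' %[mod m])%N.
    by rewrite -(modnMDl j (e * i)) -(modnMDl j' (e * i')) !(mulnC _ m) addnC eqw addnC.
  wlog le_ii' : i i' lt_i lt_i' {eqm eqw eq_val} / (i <= i')%N.
    move=> IH; case/orP: (leq_total i i') => [/IH h|/IH h]; first exact: h.
    by rewrite eq_sym => /h ->.
  rewrite eq_sym eqn_mod_dvd ?leq_mul2l ?le_ii' ?orbT // -mulnBr Euclid_dvdM //.
  rewrite (negbTE ndvd_me) /= => /dvdnP[[|k]]; first by lia.
  nia.
split=> //; move: eqw; rewrite eq_i => /addnI/eqP.
by rewrite eqn_mul2l gtn_eqF //= => /eqP.
Qed.

Section Stepanov.

Variables (L : fieldType) (p s m n t : nat) (f : {poly L}) (x c : L).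
Hypotheses (charLp : p \in [pchar L]) (m_prime : prime m).
Hypotheses (defQ : (m * n).+1 = (p ^ s)%N) (f_neq0 : f != 0).
Hypothesis mup_f : ~~ (m %| mup x f)%N.

Let Q := (p ^ s)%N.
Let d := (size f).-1.
Let M := (m * t)%N.
Let A := (n - d)%N.
Let B := (A + M * d + t)%N.
Hypothesis n_large : (t * (m * t * d + t + 1) + d < n)%N.

(** The shift by [M] leaves a power of [f] after every derivation of order [k < M], so [expo i - k]
    is never truncated. *)
Let expo (i : 'I_m) := (M + n * i)%N.

Let aux (r : {ffun 'I_m * 'I_t.+1 -> {poly_A L}}) : {poly L} :=
  \sum_(ij : 'I_m * 'I_t.+1) f ^+ expo ij.1 * r ij * ('X - x%:P) ^+ (ij.2 * Q).

(* Value of the [k]-th Hasse derivative of [aux r], divided by [f ^+ (M - k)],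
   where [f ^+ n] equals [c] and ['X ^+ Q] equals ['X]. *)
Let cond_poly (k : nat) (r : 'I_m * 'I_t.+1 -> {poly L}) : {poly L} :=
  \sum_(ij : 'I_m * 'I_t.+1) c ^+ ij.1 *: ((f ^+ expo ij.1 * r ij)^`N(k) %/ f ^+ (expo ij.1 - k))
      * ('X - (x ^+ Q)%:P) ^+ ij.2.

(** Truncation to size [B] gives a target of known dimension; by [size_cond_poly] it loses
    nothing. *)
Let cond (r : {ffun 'I_m * 'I_t.+1 -> {poly_A L}}) : {ffun 'I_M -> {poly_B L}} :=
  [ffun k : 'I_M => npolyp B (cond_poly k (fun ij => r ij))].

(** Division by [f ^+ (expo i - k)] leaves at most degree [d * k] from the power of [f], whatever
    [i] is; this makes the conditions so few. *)
Lemma size_cond_poly (k : nat) (r : {ffun 'I_m * 'I_t.+1 -> {poly_A L}}) :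
  (k < M)%N -> (size (cond_poly k (fun ij => r ij)) <= B)%N.
Proof.
move=> lt_kM; apply: leq_trans (size_sum _ _ _) _; apply/bigmax_leqP => -[i j] _ /=.
apply: leq_trans (size_polyMleq _ _) _; rewrite size_exp_XsubC addnS /=.
set w := _ %/ _; have szw : (size w <= A + M * d)%N; last first.
  apply: leq_add; last by rewrite -ltnS.
  exact: leq_trans (size_scale_leq _ _) szw.
have szN : (size (f ^+ expo i * r (i, j))^`N(k) <= d * expo i + A)%N.
  apply: leq_trans (size_nderivn _ _) _; apply: leq_trans (leq_subr _ _) _.
  apply: leq_trans (size_polyMleq _ _) _.
  rewrite -subn1 leq_subLR add1n -addSn leq_add ?size_npoly //.
  by rewrite /d -size_exp leqSpred.
have le_k : (k <= expo i)%N by rewrite /expo; lia.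
have : (d * k <= d * M)%N by rewrite leq_mul2l (ltnW lt_kM) orbT.
have : (d * k <= d * expo i)%N by rewrite leq_mul2l le_k orbT.
rewrite /w size_divp ?expf_neq0 // size_exp -/d mulnBr (mulnC M) => h1 h2.
by rewrite leq_subLR; apply: leq_trans szN _; lia.
Qed.

Lemma cond_linear : linear cond.
Proof.
move=> a u v; apply/ffunP=> k; rewrite !ffunE; apply/val_inj/polyP => l /=.
rewrite !coefE !coef_npolyp; case: ifP => _; last by rewrite mulr0 addr0.
rewrite -coefZ -coefD /cond_poly; congr (_`_l).
pose term (r : {ffun 'I_m * 'I_t.+1 -> {poly_A L}}) (ij : 'I_m * 'I_t.+1) := c ^+ ij.1 *:
  ((f ^+ expo ij.1 * r ij)^`N(k) %/ f ^+ (expo ij.1 - k)) * ('X - (x ^+ Q)%:P) ^+ ij.2.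
rewrite -/(\sum_(ij : 'I_m * 'I_t.+1) term u ij) -/(\sum_(ij : 'I_m * 'I_t.+1) term v ij) scaler_sumr -big_split /=.
rewrite (eq_bigr (fun ij => a *: term u ij + term v ij)) // => ij _.
rewrite /term !ffunE /= mulrDr -scalerAr nderivnD nderivnZ divpD divpZl.
by rewrite scalerDr mulrDl -!scalerAl !scalerA [a * _]mulrC.
Qed.

Lemma exists_aux : exists2 r : {ffun 'I_m * 'I_t.+1 -> {poly_A L}}, r != 0 & cond r = 0.
Proof.
apply: linear_kernel_neq0 cond_linear _.
(* The unknowns number [m * (t + 1) * A] and the conditions [m * t * B]; the inequality amounts to
   [t * (M * d + t) < A], which [n_large] provides. *)
change (#|{: 'I_M}| * B < #|{: 'I_m * 'I_t.+1}| * A)%N.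
rewrite card_prod !card_ord /M -!mulnA ltn_pmul2l ?prime_gt0 // /B /M mulSn.
by move: n_large; rewrite /A; nia.
Qed.

Lemma dvdp_exp_aux (r : {ffun 'I_m * 'I_t.+1 -> {poly_A L}}) (z : L) :
  cond r = 0 -> z ^+ Q = z -> f.[z] ^+ n = c -> ('X - z%:P) ^+ M %| aux r.
Proof.
move=> cond0 zQ fz; apply: dvdp_exp_XsubC_nderivn => k lt_kM.
have {}cond0 : cond_poly k (fun ij => r ij) = 0.
  have /ffunP/(_ (Ordinal lt_kM)) := cond0; rewrite !ffunE /= => /(congr1 val) /=.
  by rewrite npolypK // size_cond_poly.
have natQ : [pchar L].-nat Q by rewrite pnatX pnatE ?charLp ?(pcharf_prime charLp).
have lt_kQ : (k < Q)%N.
  by apply: leq_trans lt_kM _; rewrite /M /Q -defQ; move: n_large; nia.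
(* This explains ['X - (x ^+ Q)%:P] in [cond_poly]: the point [z] is fixed by the [Q]-power map, but
   [x] need not be. *)
have frob : (z - x) ^+ Q = z - x ^+ Q by rewrite exprDn_pchar // exprNn_pchar // zQ.
transitivity (f.[z] ^+ (M - k) * (cond_poly k (fun ij => r ij)).[z]); last first.
  by rewrite cond0 horner0 mulr0.
rewrite /aux raddf_sum !horner_sum mulr_sumr; apply: eq_bigr => -[i j] _ /=.
rewrite exprM nderivn_mul_pchar // -[X in X * _](divpK (dvdp_nderivn_expM _ _ _ _)).
rewrite -scalerAl !(hornerZ, hornerM, horner_exp, hornerXsubC) exprAC frob.
have -> : (expo i - k = M - k + n * i)%N by rewrite /expo; lia.
by rewrite [f.[z] ^+ (_ + _)]exprD [f.[z] ^+ (n * i)]exprM fz; ring.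
Qed.

Lemma mup_expn (K : fieldType) (y : K) (u : {poly K}) (e : nat) :
  u != 0 -> mup y (u ^+ e) = (e * mup y u)%N.
Proof.
move=> u_neq0; elim: e => [|e IHe]; first by rewrite mupNroot ?root1.
by rewrite exprS mupM ?expf_neq0 // IHe mulSn.
Qed.

Lemma mup_lt_size (K : fieldType) (y : K) (u : {poly K}) :
  u != 0 -> (mup y u < size u)%N.
Proof.
move=> u_neq0; rewrite mup_ltn //; apply/negP => /(dvdp_leq u_neq0).
by rewrite size_exp_XsubC ltnn.
Qed.

(** By [stepanov_mup_inj], distinct nonzero terms have distinct multiplicities at [x]. The powers of
    ['X - x%:P] are what makes [j] visible there. *)
Lemma aux_neq0 (r : {ffun 'I_m * 'I_t.+1 -> {poly_A L}}) : r != 0 -> aux r != 0.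
Proof.
move=> r_neq0; have [i1 nz_i1] : exists ij, r ij != 0.
  apply/existsP; apply: contraNT r_neq0 => /existsPn r0.
  by apply/eqP/ffunP=> ij; rewrite ffunE; apply/eqP; rewrite -[_ == _]negbK r0.
have Xx_neq0 : 'X - x%:P != 0 by rewrite polyXsubC_eq0.
have mup_term (ij : 'I_m * 'I_t.+1) : (r ij : {poly L}) != 0 ->
    mup x (f ^+ expo ij.1 * r ij * ('X - x%:P) ^+ (ij.2 * Q)) =
      (mup x f * (M + n * ij.1) + mup x (r ij) + ij.2 * Q)%N.
  move=> nz; rewrite !mupM ?mulf_neq0 ?expf_neq0 // mup_expn // mup_XsubCX eqxx.
  by rewrite mulnC.
apply: (@mup_sum_neq0 _ _ _ x i1) => [ij ij'|]; last first.
  by rewrite !mulf_neq0 ?expf_neq0.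
rewrite !mulf_eq0 !negb_or => /andP[/andP[_ nz _]] /andP[/andP[_ nz' _]].
rewrite !mup_term //.
case/(@stepanov_mup_inj m n d Q (mup x f) A); rewrite ?ltn_ord //.
- by have := mup_lt_size x f_neq0; rewrite /d; lia.
- by rewrite /A; lia.
- exact: leq_trans (mup_lt_size x nz) (size_npoly _).
- exact: leq_trans (mup_lt_size x nz') (size_npoly _).
by case: ij ij' => [i j] [i' j'] /= in nz nz' * => /val_inj -> /val_inj ->.
Qed.

Lemma size_aux (r : {ffun 'I_m * 'I_t.+1 -> {poly_A L}}) :
  (size (aux r) <= d * (M + n * m.-1) + A + t * Q)%N.
Proof.
apply: leq_trans (size_sum _ _ _) _; apply/bigmax_leqP => -[i j] _ /=.
apply: leq_trans (size_polyMleq _ _) _; rewrite size_exp_XsubC addnS /=.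
apply: leq_add; last by rewrite leq_mul2r -ltnS ltn_ord orbT.
apply: leq_trans (size_polyMleq _ _) _.
rewrite -subn1 leq_subLR add1n -addSn leq_add ?size_npoly //.
apply: leq_trans (leqSpred _) _; rewrite size_exp ltnS leq_mul // leq_add2l leq_mul //.
by have := ltn_ord i; lia.
Qed.

(** Compare [M * size Z] with the degree of [aux r]. After division by [m * t], the bound reads
    [Q / m * (1 + (d + 1) / t) + d], so a large [t] brings it close to [Q / m]. *)
Lemma stepanov_bound (Z : seq L) : uniq Z ->
    (forall z, z \in Z -> z ^+ (p ^ s) = z /\ f.[z] ^+ n = c) ->
  (m * t * size Z <= m * t * (size f).-1 + p ^ s * ((size f).-1 + t + 1))%N.
Proof.
move=> uniqZ ptsZ; have [r r_neq0 cond0] := exists_aux.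
have /(dvdp_leq (aux_neq0 r_neq0)) : (\prod_(z <- Z) ('X - z%:P)) ^+ M %| aux r.
  by apply: dvdp_prod_exp_XsubC => // z /ptsZ[zQ fz]; apply: dvdp_exp_aux.
rewrite polySpred ?expf_neq0 ?monic_neq0 ?monic_prod_XsubC //.
rewrite size_exp size_prod_XsubC /= => le_size.
have le_nm : (n * m.-1 <= Q)%N.
  by rewrite /Q -defQ leqW // mulnC leq_mul2r leq_pred orbT.
have le_nQ : (n <= Q)%N by rewrite /Q -defQ leqW // leq_pmull ?prime_gt0.
have := leq_mul (leqnn d) le_nm; have := leq_trans (leq_subr d n) le_nQ.
move: (leq_trans le_size (size_aux r)); rewrite mulnC -/M -/Q -/d -/A.
rewrite !(mulnDr, muln1) (mulnC M d) (mulnC Q d) (mulnC Q t) => lt_M le_A le_dn.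
by apply: leq_trans (ltnW lt_M) _; lia.
Qed.

End Stepanov.

(** * Irreducible polynomials over a finite field *)

Lemma size_Xn_sub_X (R : nzRingType) (Q : nat) : (1 < Q)%N -> size ('X^Q - 'X : {poly R}) = Q.+1.
Proof. by move=> Q_gt1; rewrite size_polyDl ?size_polyXn // size_polyN size_polyX. Qed.

Lemma separable_Xn_sub_X (L : fieldType) (p s : nat) :
  p \in [pchar L] -> (0 < s)%N -> separable_poly ('X^(p ^ s) - 'X : {poly L}).
Proof.
move=> charLp s_gt0; rewrite separable_poly.unlock derivB derivXn derivX -mulr_natl.
have /eqP-> : ((p ^ s)%:R : {poly L}) == 0.
  by rewrite natrX expf_eq0 s_gt0 -polyC_natr (pcharf0 charLp) polyC0 eqxx.
by rewrite mul0r sub0r -[X in coprimep _ X]scaleN1r coprimepZr ?coprimep1 // oppr_eq0 oner_eq0.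
Qed.

Lemma irred_dvdp_polyC (L : fieldType) (P : {poly L}) (c : L) :
  irreducible_poly P -> P %| c%:P -> c = 0.
Proof.
case=> size_P _; apply: contraTeq => c_neq0; apply: contraL size_P => /dvdp_leq.
by rewrite polyC_eq0 c_neq0 size_polyC c_neq0 -leqNgt; apply.
Qed.

Section FiniteFieldPolynomials.

Variable F : finFieldType.
Let q := #|F|.

Lemma card_finField_gt1 : (1 < q)%N. Proof. exact: finNzRing_gt1. Qed.

Lemma expf_card_iter (c : F) (k : nat) : c ^+ (q ^ k) = c.
Proof. by elim: k => [|k IHk]; rewrite ?expr1 // expnSr exprM IHk expf_card. Qed.

Lemma card_finField_pchar : {p : nat & {s : nat | p \in [pchar F] & q = (p ^ s)%N}}.
Proof.
have [p p_prime charFp] := finPcharP F; exists p.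
by exists (logn p #|F|) => //; rewrite -[RHS](card_pprimeChar charFp).
Qed.

Lemma card_nat_pchar (k : nat) : [pchar F].-nat (q ^ k)%N.
Proof.
have [p [s charFp ->]] := card_finField_pchar.
by rewrite -expnM pnatX pnatE ?charFp ?(pcharf_prime charFp).
Qed.

(** Modulo [P], the [q ^ k]-power map is a ring morphism that fixes the constants and, by
    hypothesis, ['X]; hence it is the identity. *)
Lemma dvdp_Frobenius (P a : {poly F}) (k : nat) :
  P %| 'X^(q ^ k) - 'X -> P %| a ^+ (q ^ k) - a.
Proof.
move=> dvdP; have q0 : (0 < q ^ k)%N by rewrite expn_gt0 ltnW // card_finField_gt1.
elim/poly_ind: a => [|a c IHa]; first by rewrite expr0n gtn_eqF // subrr dvdp0.
rewrite exprDn_pchar; last by rewrite (eq_pnat _ (pchar_poly F)) card_nat_pchar.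
rewrite exprMn -rmorphXn /= expf_card_iter.
have -> : a ^+ (q ^ k) * 'X ^+ (q ^ k) + c%:P - (a * 'X + c%:P) =
    a ^+ (q ^ k) * ('X^(q ^ k) - 'X) + (a ^+ (q ^ k) - a) * 'X by ring.
by apply: dvdp_add; [apply: dvdp_mull | apply: dvdp_mulr].
Qed.

Section MonicIrreducible.

Variable P : {poly F}.
Hypotheses (mP : P \is monic) (iP : irreducible_poly P).
Let d := (size P).-1.

Lemma irred_size_gt1 : (1 < size P)%N. Proof. by case: iP. Qed.

Let hI : monic_irreducible_poly P. Proof. by split. Qed.

Lemma in_qpoly_eq0 (u : {poly F}) : (in_qpoly P u == 0) = (P %| u).
Proof. by rewrite dvdp_in_qpoly // irred_size_gt1. Qed.

Lemma dvdp_irred_Xcard : P %| 'X^(q ^ d) - 'X.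
Proof.
rewrite -in_qpoly_eq0 rmorphB rmorphXn /= subr_eq0; apply/eqP.
have cardK : #|{poly %/ P with hI}| = (q ^ d)%N := card_monic_qpoly irred_size_gt1 mP.
by rewrite -cardK; apply: (@expf_card {poly %/ P with hI}).
Qed.

(** All [q ^ d] elements of the residue field are roots of ['X^(q ^ k) - 'X]. *)
Lemma leq_degree_of_dvdp (k : nat) : (0 < k)%N -> P %| 'X^(q ^ k) - 'X -> (d <= k)%N.
Proof.
move=> k_gt0 dvdP; pose K : finFieldType := {poly %/ P with hI}.
have cardK : #|K| = (q ^ d)%N := card_monic_qpoly irred_size_gt1 mP.
have qk_gt1 : (1 < q ^ k)%N by rewrite -(exp1n k) ltn_exp2r // card_finField_gt1.
have nz : ('X^(q ^ k) - 'X : {poly K}) != 0 by rewrite -size_poly_eq0 size_Xn_sub_X.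
have := max_poly_roots nz _ (enum_uniq K).
rewrite -cardE cardK size_Xn_sub_X // ltnS leq_exp2l ?card_finField_gt1 //; apply.
apply/allP=> y _; rewrite rootE !hornerE subr_eq0; apply/eqP.
have -> : y = in_qpoly P (val y) :> K.
  by apply/esym/val_inj/in_qpoly_small/size_mk_monic.
rewrite -(rmorphXn (in_qpoly P)) /=; apply/eqP.
by rewrite -subr_eq0 -(rmorphB (in_qpoly P)) in_qpoly_eq0 dvdp_Frobenius.
Qed.

End MonicIrreducible.

End FiniteFieldPolynomials.

Lemma irred_dvdp_root (F L : fieldType) (emb : {rmorphism F -> L}) (P a : {poly F}) (y : L) :
    irreducible_poly P -> root (map_poly emb P) y -> root (map_poly emb a) y ->
  P %| a.
Proof.
move=> iP rPy ray; apply/negPn; rewrite -irreducible_poly_coprime //; apply/negP.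
by rewrite -(coprimep_map emb) => /coprimep_root /(_ rPy); rewrite (rootP ray) eqxx.
Qed.

(** Descent on the size: once no smaller divisor of [a] vanishes at [y], the polynomial is
    irreducible up to scaling, since one factor of any factorization vanishes at [y]. *)
Lemma exists_monic_irred_root (F L : fieldType) (emb : {rmorphism F -> L}) (a : {poly F}) (y : L) :
    a != 0 -> root (map_poly emb a) y ->
  exists P, [/\ P \is monic, irreducible_poly P, P %| a & root (map_poly emb P) y].
Proof.
have [k] := ubnP (size a); elim: k a => // k IHk a lt_k a_neq0 ray.
have size_gt1 (b : {poly F}) : b != 0 -> root (map_poly emb b) y -> (1 < size b)%N.
  move=> b_neq0 rby; rewrite -(size_map_poly emb); apply: root_size_gt1 rby.
  by rewrite map_poly_eq0.
have [[b [b_neq0 lt_ba rby dvdba]]|no_b] := pselect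
    (exists b : {poly F}, [/\ b != 0, (size b < size a)%N, root (map_poly emb b) y & b %| a]).
  have [|P [mP iP dvdPb rPy]] := IHk b _ b_neq0 rby.
    by rewrite -ltnS (leq_trans _ lt_k).
  by exists P; split=> //; apply: dvdp_trans dvdba.
pose P := (lead_coef a)^-1 *: a.
have lc_neq0 : (lead_coef a)^-1 != 0 by rewrite invr_eq0 lead_coef_eq0.
have eqPa : P %= a by apply: eqp_scale.
exists P; split.
- by rewrite monicE lead_coefZ mulVf // lead_coef_eq0.
- split=> [|b size_b]; first by rewrite size_scale ?size_gt1.
  rewrite (eqp_dvdr _ eqPa) (eqp_rtrans eqPa) => dvdba.
  rewrite -dvdp_size_eqp // eqn_leq dvdp_leq //=.
  have b_neq0 : b != 0 by apply: contraNneq a_neq0 => b0; rewrite -dvd0p -b0.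
  have /dvdpP[b' def_a] := dvdba; rewrite leqNgt; apply/negP => lt_ba.
  have b'_neq0 : b' != 0 by apply: contraNneq a_neq0 => b0; rewrite def_a b0 mul0r.
  move: ray; rewrite def_a rmorphM rootM => /orP[ry|ry]; apply: no_b.
    exists b'; split=> //; last by rewrite def_a dvdp_mulr.
    rewrite def_a size_mul //; have := size_poly_gt0 b; rewrite b_neq0 => sb.
    by move: size_b sb; case: (size b) => [|[|sb]] // _ _; rewrite !addnS /= ltnS leq_addr.
  by exists b.
- by rewrite (eqp_dvdl _ eqPa).
by rewrite /P map_polyZ rootZ // fmorph_eq0.
Qed.

(** * Roots of irreducible polynomials in an algebraically closed field *)

Section ClosedField.

Variables (F : finFieldType) (L : closedFieldType) (emb : {rmorphism F -> L}).
Let q := #|F|.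
Implicit Type P : {poly F}.

Local Notation "P ^L" := (map_poly emb P) (at level 2, format "P ^L").

Definition rootseq (u : {poly L}) : seq L := sval (closed_field_poly_normal u).

Lemma rootseqE (u : {poly L}) :
  u \is monic -> u = \prod_(z <- rootseq u) ('X - z%:P).
Proof.
move=> /monicP lc1; rewrite /rootseq; case: closed_field_poly_normal => r /= def_u.
by rewrite [LHS]def_u lc1 scale1r.
Qed.

Lemma mem_rootseq (u : {poly L}) (z : L) : u \is monic -> (z \in rootseq u) = root u z.
Proof. by move=> mu; rewrite [in RHS](rootseqE mu) root_prod_XsubC. Qed.

Lemma size_rootseq (u : {poly L}) : u \is monic -> size (rootseq u) = (size u).-1.
Proof. by move=> mu; rewrite [in RHS](rootseqE mu) size_prod_XsubC. Qed.

Lemma uniq_rootseq (u : {poly L}) : u \is monic -> separable_poly u -> uniq (rootseq u).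
Proof. by move=> mu; rewrite [in X in X -> _](rootseqE mu) separable_prod_XsubC. Qed.

Lemma separable_Xcard (k : nat) : (0 < k)%N -> separable_poly ('X^(q ^ k) - 'X : {poly L}).
Proof.
move=> k_gt0; have [p [s charFp eq_q]] := card_finField_pchar F.
have s_gt0 : (0 < s)%N.
  by have := card_finField_gt1 F; rewrite eq_q; case: (s).
by rewrite /q eq_q -expnM (@separable_Xn_sub_X _ p) ?(fmorph_pchar emb) // muln_gt0 s_gt0.
Qed.

Lemma map_Xcard (k : nat) : ('X^(q ^ k) - 'X : {poly F})^L = 'X^(q ^ k) - 'X.
Proof. by rewrite rmorphB /= map_polyXn map_polyX. Qed.

Lemma root_Xcard (k : nat) (z : L) : root ('X^(q ^ k) - 'X) z = (z ^+ (q ^ k) == z).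
Proof. by rewrite rootE !hornerE subr_eq0. Qed.

Section Irreducible.

Variable P : {poly F}.
Hypotheses (mP : P \is monic) (iP : irreducible_poly P).

Lemma irred_degree_gt0 : (0 < (size P).-1)%N.
Proof. by rewrite -subn1 subn_gt0 irred_size_gt1. Qed.

Lemma uniq_rootseq_irred : uniq (rootseq P^L).
Proof.
apply: uniq_rootseq; first exact: monic_map.
have := separable_Xcard irred_degree_gt0; rewrite -map_Xcard.
by case/dvdpP: (dvdp_irred_Xcard mP iP) => u ->; rewrite rmorphM separable_mul => /and3P[].
Qed.

Lemma irred_root_Frobenius (y : L) : root P^L y -> y ^+ (q ^ (size P).-1) = y.
Proof.
move=> rPy; apply/eqP; rewrite -root_Xcard -map_Xcard.
by case/dvdpP: (dvdp_irred_Xcard mP iP) => u ->; rewrite rmorphM rootM rPy orbT.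
Qed.

Lemma dvdn_degree_of_root (y : L) (k : nat) :
  (0 < k)%N -> root P^L y -> y ^+ (q ^ k) = y -> ((size P).-1 %| k)%N.
Proof.
set d := (size P).-1 => k_gt0 rPy yk; have yd := irred_root_Frobenius rPy.
have iter (a b : nat) : y ^+ (q ^ b) = y -> y ^+ (q ^ (a * b)) = y.
  by move=> yb; elim: a => [|a IHa]; rewrite ?expr1 // mulSn expnD exprM yb.
(* By Bezout, [a * d = b * k + gcdn d k], and [y] is fixed by the powers [q ^ (b * k)] and
   [q ^ (a * d)]. Then [P] divides ['X^(q ^ gcdn d k) - 'X], which bounds [d] by the gcd. *)
have yg : y ^+ (q ^ gcdn d k) = y.
  case: (egcdnP k irred_degree_gt0) => a b eq_ab _.
  by rewrite -{1}(iter b k yk) -exprM -expnD -eq_ab iter.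
have g_gt0 : (0 < gcdn d k)%N by rewrite gcdn_gt0 k_gt0 orbT.
have dvdg : P %| 'X^(q ^ gcdn d k) - 'X.
  by apply: irred_dvdp_root rPy _ => //; rewrite map_Xcard root_Xcard yg.
have le_dg := leq_degree_of_dvdp mP iP g_gt0 dvdg.
suff <- : gcdn d k = d by exact: dvdn_gcdr.
by apply/eqP; rewrite eqn_leq le_dg dvdn_leq ?irred_degree_gt0 ?dvdn_gcdl.
Qed.

End Irreducible.

Lemma irred_common_root P1 P2 (y : L) :
    P1 \is monic -> irreducible_poly P1 -> P2 \is monic -> irreducible_poly P2 ->
  root P1^L y -> root P2^L y -> P1 = P2.
Proof.
move=> mP1 iP1 mP2 iP2 r1 r2; apply/eqP; rewrite -eqp_monic // /eqp.
by rewrite !(irred_dvdp_root (emb := emb) (y := y)).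
Qed.

Lemma uniq_flatten_rootseq (Ps : seq {poly F}) :
    uniq Ps -> (forall P, P \in Ps -> P \is monic /\ irreducible_poly P) ->
  uniq (flatten [seq rootseq P^L | P <- Ps]).
Proof.
elim: Ps => //= P Ps IHPs /andP[PPs uniqPs] irrPs.
have [mP iP] := irrPs _ (mem_head _ _).
have {}irrPs P' : P' \in Ps -> P' \is monic /\ irreducible_poly P'.
  by move=> P'Ps; apply: irrPs; rewrite inE P'Ps orbT.
rewrite cat_uniq uniq_rootseq_irred // IHPs // andbT.
apply/hasPn => y /flatten_mapP[P' P'Ps]; have [mP' iP'] := irrPs _ P'Ps.
rewrite mem_rootseq ?monic_map // => rP'y; rewrite mem_rootseq ?monic_map //.
apply: contra PPs => rPy; suff -> : P = P' by [].
exact: irred_common_root rPy rP'y.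
Qed.

Lemma size_flatten_rootseq (Ps : seq {poly F}) (N : nat) :
    (forall P, P \in Ps -> P \is monic /\ size P = N.+1) ->
  size (flatten [seq rootseq P^L | P <- Ps]) = (N * size Ps)%N.
Proof.
elim: Ps => [|P Ps IHPs] sizePs; first by rewrite muln0.
have [mP szP] := sizePs _ (mem_head _ _).
rewrite /= size_cat IHPs ?size_rootseq ?monic_map ?size_map_poly ?szP ?mulnS //.
by move=> P' P'Ps; apply: sizePs; rewrite inE P'Ps orbT.
Qed.

(* The elements of [L] outside the smaller fields F_(q^k), [k <= N/2], that are
   fixed by the [q^N]-power map have degree exactly [N]. *)
Lemma card_irred_geq (Ps : seq {poly F}) (N : nat) : (0 < N)%N ->
    (forall P, P \is monic -> irreducible_poly P -> size P = N.+1 -> P \in Ps) ->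
    (forall P, P \in Ps -> P \is monic /\ size P = N.+1) ->
  (q ^ N <= N * size Ps + q ^ (N./2).+1)%N.
Proof.
move=> N_gt0 allPs Ps_monic; have q_gt1 : (1 < q)%N := card_finField_gt1 F.
have qk_gt1 k : (0 < k)%N -> (1 < q ^ k)%N by move=> k_gt0; rewrite -(exp1n k) ltn_exp2r.
have mX k : (0 < k)%N -> ('X^(q ^ k) - 'X : {poly L}) \is monic.
  move=> k_gt0; rewrite monicE lead_coefDl ?lead_coefXn ?size_polyXn //.
  by rewrite size_polyN size_polyX ltnS qk_gt1.
have szX k : (0 < k)%N -> size (rootseq ('X^(q ^ k) - 'X)) = (q ^ k)%N.
  by move=> k_gt0; rewrite size_rootseq ?mX // size_Xn_sub_X // qk_gt1.
pose small := flatten [seq rootseq ('X^(q ^ k) - 'X) | k <- iota 1 N./2].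
have size_small : (size small <= q ^ (N./2).+1)%N.
  rewrite /small; elim: (N./2) => // h IHh.
  have -> : iota 1 h.+1 = iota 1 h ++ [:: h.+1] by rewrite -[in LHS](addn1 h) iotaD add1n.
  rewrite map_cat flatten_cat size_cat /= cats0 szX // [X in (_ <= X)%N]expnS.
  apply: leq_trans (_ : 2 * q ^ h.+1 <= _)%N; first by rewrite mul2n -addnn leq_add2r.
  by rewrite leq_mul2r q_gt1 orbT.
rewrite -(szX N) // -(size_flatten_rootseq Ps_monic).
apply: (leq_trans _ (leq_add (leqnn _) size_small)); rewrite -size_cat.
apply: uniq_leq_size; first by rewrite uniq_rootseq ?mX ?separable_Xcard.
move=> y; rewrite mem_rootseq ?mX // => ry.
have nz : ('X^(q ^ N) - 'X : {poly F}) != 0 by rewrite -size_poly_eq0 size_Xn_sub_X ?qk_gt1.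
have [|P [mP iP _ rPy]] := exists_monic_irred_root (emb := emb) (y := y) nz.
  by rewrite map_Xcard.
rewrite mem_cat; have yN : y ^+ (q ^ N) = y by apply/eqP; rewrite -root_Xcard.
have dvdN := dvdn_degree_of_root mP iP N_gt0 rPy yN.
have d_gt0 := irred_degree_gt0 iP; set d := (size P).-1 in dvdN d_gt0.
have [eq_dN|ne_dN] := eqVneq d N.
  apply/orP; left; apply/flatten_mapP; exists P; last by rewrite mem_rootseq ?monic_map.
  by apply: allPs => //; rewrite -eq_dN /d prednK // ltnW // irred_size_gt1.
apply/orP; right; apply/flatten_mapP; exists d; last first.
  by rewrite mem_rootseq ?mX // root_Xcard irred_root_Frobenius.
rewrite mem_iota d_gt0 add1n ltnS; case/dvdnP: dvdN ne_dN => -[|[|k]] eq_N.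
- by rewrite eq_N in N_gt0.
- by rewrite eq_N mul1n eqxx.
(* A proper divisor of [N] is at most [N / 2]. *)
by rewrite -(doubleK d) half_leq // eq_N -mul2n leq_mul2r orbT.
Qed.

(** Removing a factor [P ^+ m] changes multiplicities by multiples of [m] and keeps the hypothesis.
    When none is left at [P], the exact exponent of [P] lies strictly between 0 and [m], and it is
    the multiplicity at [y] because [P] has simple roots. *)
Lemma exists_root_mup_ndvd (m : nat) (E : {poly F}) : (0 < m)%N -> E != 0 ->
    (forall (c : F) (G : {poly F}), E != c *: G ^+ m) ->
  exists y, ~~ (m %| mup y E^L)%N.
Proof.
move=> m_gt0; have [k] := ubnP (size E); elim: k E => // k IHk E lt_k E_neq0 not_pow.
have [y ry] : exists y, root E^L y.
  (* Without a root, [E] would be a constant, that is, a constant times [1 ^+ m]. *)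
  apply/closed_rootP; rewrite size_map_poly; apply: contra (not_pow E`_0 1).
  by move=> /eqP szE; rewrite expr1n alg_polyC -size1_polyC // szE.
have [P [mP iP dvdPE rPy]] := exists_monic_irred_root E_neq0 ry.
have P_neq0 := monic_neq0 mP.
have mupP (z : L) : root P^L z -> mup z P^L = 1%N.
  move=> rz; rewrite {1}(rootseqE (monic_map emb mP)) mu_prod_XsubC.
  by rewrite count_uniq_mem ?uniq_rootseq_irred // mem_rootseq ?monic_map // rz.
have [/dvdpP[E' def_E]|ndvd] := boolP (P ^+ m %| E).
  have E'_neq0 : E' != 0 by apply: contraNneq E_neq0 => e0; rewrite def_E e0 mul0r.
  have [|//|c G|z ndvd_z] := IHk E'.
  - rewrite -ltnS; apply: leq_trans lt_k; rewrite def_E ltnS size_mul ?expf_neq0 //.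
    have szP : (1 < size (P ^+ m))%N.
      by rewrite -subn_gt0 subn1 size_exp muln_gt0 irred_degree_gt0.
    by move: szP; case: (size (P ^+ m)) => [|[|sP]] // _; rewrite !addnS /= !ltnS leq_addr.
  - apply: contra (not_pow c (G * P)) => /eqP def_E'.
    by rewrite def_E def_E' exprMn scalerAl.
  exists z; rewrite def_E rmorphM rmorphXn /= mupM ?expf_neq0 ?map_poly_eq0 //.
  by rewrite mup_expn ?map_poly_eq0 // dvdn_addl // dvdn_mulr.
have [[|j]] := ex_minnP (ex_intro (fun j => ~~ (P ^+ j %| E)) m ndvd); first by rewrite dvd1p.
move=> ndvdj min_j; have /dvdpP[E' def_E] : P ^+ j %| E.
  by apply: contraT => /min_j; rewrite ltnn.
have ndvdE' : ~~ (P %| E').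
  by apply: contra ndvdj => dvdE'; rewrite def_E exprS dvdp_mul.
have E'_neq0 : E' != 0 by apply: contraNneq E_neq0 => e0; rewrite def_E e0 mul0r.
exists y; rewrite def_E rmorphM rmorphXn /= mupM ?expf_neq0 ?map_poly_eq0 //.
rewrite mup_expn ?map_poly_eq0 // mupP // muln1 mupNroot; last first.
  by apply: contra ndvdE' => rE'; apply: irred_dvdp_root rPy rE'.
rewrite add0n gtnNdvd ?min_j // lt0n.
by apply: contraNneq ndvdj => ->; rewrite expr1.
Qed.

End ClosedField.

(** * Equidistribution of power residues *)

Section Counting.

Variable F : finFieldType.
Let q := #|F|.
Local Notation pi_ := (count_degree (@monic_irreducible F)).

Definition degree_seq (T : set {poly F}) (N : nat) : seq {poly F} :=
  [seq val P | P <- enum [set P : {poly_N.+1 F} | (size P == N.+1) && `[< T P >]]%SET].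

Lemma size_degree_seq (T : set {poly F}) (N : nat) :
  size (degree_seq T N) = count_degree T N.
Proof. by rewrite size_map -cardE. Qed.

Lemma uniq_degree_seq (T : set {poly F}) (N : nat) : uniq (degree_seq T N).
Proof. by rewrite map_inj_uniq ?enum_uniq //; apply: val_inj. Qed.

Lemma mem_degree_seq (T : set {poly F}) (N : nat) (P : {poly F}) :
  P \in degree_seq T N <-> size P = N.+1 /\ T P.
Proof.
split=> [/mapP[P' + ->]|[szP TP]].
  by rewrite mem_enum inE => /andP[/eqP szP' /asboolP TP'].
have leP : (size P <= N.+1)%N by rewrite szP.
apply/mapP; exists (npolyp N.+1 P); last exact/esym/npolypK.
by rewrite mem_enum inE npolypK // szP eqxx /=; apply/asboolP.
Qed.

(** The lower half of the prime polynomial theorem, with [1/K] for the relative error so as to stay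
    in the natural numbers. *)
Lemma pi_lower (K : nat) : exists N0, forall N, (N0 <= N)%N ->
  (K * q ^ N <= K * (N * pi_ N) + q ^ N)%N.
Proof.
have [L [emb _]] := countable_algebraic_closure F.
(* For such [N], the exponents [N] and [N./2 + 1] differ by at least [K], so
   [K * q ^ (N./2 + 1) <= q ^ N]. *)
exists (2 * K + 4)%N => N le_N; have N_gt0 : (0 < N)%N by lia.
have q_gt1 : (1 < q)%N := card_finField_gt1 F.
have bound : (q ^ N <= N * pi_ N + q ^ (N./2).+1)%N.
  rewrite -size_degree_seq; apply: (card_irred_geq emb N_gt0) => [P mP iP szP|P].
    exact/mem_degree_seq.
  by case/mem_degree_seq => szP [].
apply: leq_trans (leq_mul (leqnn K) bound) _; rewrite mulnDr leq_add2l.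
have le_h : ((N./2).+1 <= N)%N by lia.
rewrite -{2}(subnK le_h) expnD leq_mul2r; apply/orP; right.
apply: leq_trans (ltnW (ltn_expl _ q_gt1)); lia.
Qed.

Variables (m : nat) (m_prime : prime m) (m_dvd : (m %| q - 1)%N).

(** The congruence is used instead of [residue_symbol] because evaluating it at a root of [P] gives
    the equation needed for Stepanov's bound. *)
Definition residue_class (E : {poly F}) (c : F) : set {poly F} :=
  [set P | monic_irreducible P /\
           P %| E ^+ ((q ^ (size P).-1 - 1) %/ m) - c%:P]%classic.

Lemma mul_divn_card (N : nat) : (m * ((q ^ N - 1) %/ m)).+1 = (q ^ N)%N.
Proof.
rewrite mulnC divnK; last by apply: dvdn_trans m_dvd _; rewrite !subn1 dvdn_pred_predX.
by rewrite subn1 prednK // expn_gt0 ltnW // card_finField_gt1.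
Qed.

(** Each prime of degree [N] contributes [N] simple roots, and distinct primes share none. *)
Lemma residue_class_points (L : closedFieldType) (emb : {rmorphism F -> L})
    (E : {poly F}) (c : F) (N : nat) : (0 < N)%N ->
  exists Z : seq L, [/\ uniq Z, size Z = (N * count_degree (residue_class E c) N)%N &
    forall z, z \in Z -> z ^+ (q ^ N) = z /\
      (map_poly emb E).[z] ^+ ((q ^ N - 1) %/ m) = emb c].
Proof.
move=> N_gt0; pose Ps := degree_seq (residue_class E c) N.
have irrPs P : P \in Ps -> [/\ P \is monic, irreducible_poly P, size P = N.+1 &
    P %| E ^+ ((q ^ N - 1) %/ m) - c%:P].
  by case/mem_degree_seq => szP [[mP iP]]; rewrite szP.
exists (flatten [seq rootseq (map_poly emb P) | P <- Ps]); split.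
- apply: uniq_flatten_rootseq; first exact: uniq_degree_seq.
  by move=> P /irrPs[].
- by rewrite (@size_flatten_rootseq _ _ _ _ N) ?size_degree_seq // => P /irrPs[].
move=> z /flatten_mapP[P /irrPs[mP iP szP dvdP]].
rewrite mem_rootseq ?monic_map // => rPz; split.
  by rewrite -[N]/(N.+1.-1) -szP; apply: irred_root_Frobenius rPz.
have : root (map_poly emb (E ^+ ((q ^ N - 1) %/ m) - c%:P)) z.
  by case/dvdpP: dvdP => u ->; rewrite rmorphM rootM rPz orbT.
by rewrite rmorphB rmorphXn /= map_polyC rootE !hornerE subr_eq0 => /eqP.
Qed.

Lemma residue_class_upper (E : {poly F}) (K : nat) : E != 0 ->
    (forall (c : F) (G : {poly F}), E != c *: G ^+ m) ->
  exists N0, forall N, (N0 <= N)%N -> forall c,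
    (m * K * (N * count_degree (residue_class E c) N) <= K.+1 * q ^ N)%N.
Proof.
move=> E_neq0 not_pow; have [L [emb _]] := countable_algebraic_closure F.
have [x ndvd_x] := exists_root_mup_ndvd emb (prime_gt0 m_prime) E_neq0 not_pow.
have [p [s charFp def_q]] := card_finField_pchar F.
(* Multiplied by [K], Stepanov's bound has the error terms [K * (d + 1) * Q] and [K * m * t * d].
   Each is at most [t * Q / 2], the first by the choice of [t], the second for large [N]. *)
pose d := (size E).-1; pose t := (2 * (K * d.+1)).+1.
pose X := (t * (m * t * d + t + 1) + d)%N.
exists (m * X.+1 + 2 * (K * (m * d))).+1 => N le_N c.
have [Z [uniqZ szZ ptsZ]] := residue_class_points emb E c (leq_trans (ltn0Sn _) le_N).
have lt_Nq : (N < q ^ N)%N by rewrite ltn_expl // card_finField_gt1.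
have m_gt0 := prime_gt0 m_prime.
have n_large : (X < (q ^ N - 1) %/ m)%N by rewrite leq_divRL // mulnC; lia.
have EL_neq0 : map_poly emb E != 0 by rewrite map_poly_eq0.
have szEL : (size (map_poly emb E)).-1 = d by rewrite size_map_poly.
have := @stepanov_bound L p (s * N) m ((q ^ N - 1) %/ m) t (map_poly emb E) x (emb c).
rewrite szEL (fmorph_pchar emb) expnM -def_q -/q => /(_ charFp m_prime (mul_divn_card N)).
move=> /(_ EL_neq0 ndvd_x n_large Z uniqZ ptsZ); rewrite szZ.
set B := (N * _)%N; set Q := (q ^ N)%N => bound.
have Q_large : (2 * (K * (m * d)) <= Q)%N.
  by apply: leq_trans (ltnW lt_Nq); apply: leq_trans le_N; rewrite leqW // leq_addl.
rewrite -(leq_pmul2l (ltn0Sn (2 * (K * d.+1)))) -/t.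
have h1 := leq_mul (leqnn t) Q_large; have h2 := leq_mul (leqnn Q) (leqnSn (2 * (K * d.+1))).
have h3 := leq_mul (leqnn K) bound; rewrite -/t in h2.
by clear -h1 h2 h3; clearbody t Q B d; nia.
Qed.

Lemma residue_symbol_unity (a P : {poly F}) :
  P \is monic -> irreducible_poly P -> ~~ (P %| a) -> residue_symbol m a P ^+ m = 1.
Proof.
move=> mP iP ndvd; set c := residue_symbol m a P.
have [c_neq0 dvdc] := (residue_symbolP c m_dvd mP iP ndvd).1 erefl.
set n := (_ %/ m)%N in dvdc.
have dvd1 : P %| a ^+ (n * m) - 1.
  have := dvdp_Frobenius a (dvdp_irred_Xcard mP iP).
  rewrite -(mul_divn_card (size P).-1) exprS mulnC.
  have -> u : a * u - a = a * (u - 1) :> {poly F} by rewrite mulrBr mulr1.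
  by rewrite Gauss_dvdpr // irreducible_poly_coprime.
have dvdm : P %| (a ^+ n) ^+ m - (c%:P) ^+ m by rewrite subrXX dvdp_mulr.
have : P %| (c ^+ m - 1)%:P.
  have -> : (c ^+ m - 1)%:P = (a ^+ (n * m) - 1) - ((a ^+ n) ^+ m - c%:P ^+ m) :> {poly F}.
    by rewrite exprM polyCB rmorphXn /=; ring.
  by rewrite dvdp_sub.
by move/(irred_dvdp_polyC iP)/eqP; rewrite subr_eq0 => /eqP.
Qed.

Lemma card_unity_roots : (#|[pred c : F | c ^+ m == 1%R]| <= m)%N.
Proof.
rewrite cardE; apply: max_unity_roots (enum_uniq _); first exact: prime_gt0.
by apply/allP => c; rewrite mem_enum inE => /eqP cm; apply/unity_rootP.
Qed.

(** A prime of degree [N] is too large to divide [E], so its symbol is an [m]-th root of unity and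
    places it in one of these classes. *)
Lemma leq_pi_residue_class (E : {poly F}) (N : nat) : E != 0 -> (size E <= N)%N ->
  (pi_ N <= \sum_(c : F | c ^+ m == 1%R) count_degree (residue_class E c) N)%N.
Proof.
move=> E_neq0 le_N; rewrite /count_degree -sum1_card.
under [leqRHS]eq_bigr => c _ do rewrite -sum1_card big_mkcond /=.
rewrite exchange_big /= big_mkcond leq_sum // => P _; case: ifP => //.
rewrite inE => /andP[/eqP szP /asboolP[mP iP]].
have ndvd : ~~ (P %| E).
  by apply/negP => /(dvdp_leq E_neq0); rewrite szP => /leq_trans/(_ le_N); rewrite ltnn.
set c := residue_symbol m E P.
have [_ dvdc] := (residue_symbolP c m_dvd mP iP ndvd).1 erefl.
rewrite (bigD1 c) ?residue_symbol_unity //= inE szP eqxx /=.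
by case: asboolP => // -[]; split=> //; split.
Qed.

(** The lower bound comes from subtracting the upper bounds of the at most [m - 1] other classes
    from [pi_ N]. *)
Lemma residue_class_equidistributed (E : {poly F}) (k : nat) : E != 0 ->
    (forall (c : F) (G : {poly F}), E != c *: G ^+ m) ->
  exists N0, forall N, (N0 <= N)%N ->
    let B := count_degree (residue_class E 1) N in
    [/\ (0 < pi_ N)%N, (k * (m * B) <= k.+2 * pi_ N)%N &
        (k * pi_ N <= k * (m * B) + 2 * (m * pi_ N))%N].
Proof.
move=> E_neq0 not_pow.
(* With error [1/(k+1)] in both estimates, the ratio of [(k+2)/(k+1)] to [k/(k+1)] is [(k+2)/k]. The
   third estimate only ensures that [pi_ N] is positive. *)
have [N1 upper] := residue_class_upper k.+1 E_neq0 not_pow.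
have [N2 lower] := pi_lower k.+1; have [N3 lower2] := pi_lower 2.
exists (N1 + N2 + N3 + size E + 1)%N => N le_N B.
have {upper} upper := upper N (ltac:(lia)).
have {lower} lower := lower N (ltac:(lia)).
have {lower2} lower2 := lower2 N (ltac:(lia)).
have le_E : (size E <= N)%N by lia.
have N_gt0 : (0 < N)%N by lia.
have Q_gt0 : (0 < q ^ N)%N by rewrite expn_gt0 ltnW ?card_finField_gt1.
have pi_sum := leq_pi_residue_class E_neq0 le_E.
rewrite (bigD1 1) ?expr1n //= -/B in pi_sum.
set S := (\sum_(_ | _) _)%N in pi_sum.
have bound_S : (m * k.+1 * (N * S) <= m.-1 * (k.+2 * q ^ N))%N.
  rewrite /S big_distrr big_distrr /=.
  apply: leq_trans (leq_sum _ (fun c _ => upper c)) _.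
  rewrite sum_nat_const leq_mul2r; apply/orP; right.
  have := card_unity_roots; rewrite (cardD1 1) inE expr1n eqxx /= add1n.
  have -> : #|[predD1 [pred c : F | c ^+ m == 1%R] & 1%R]| = #|[pred c : F | (c ^+ m == 1%R) && (c != 1%R)]|.
    by apply: eq_card => c; rewrite !inE andbC.
  by case: (m).
split.
- by move: lower2; case: (pi_ N) => //; rewrite muln0; lia.
- have h1 := leq_mul (leqnn k) (upper 1); have h2 := leq_mul (leqnn k.+2) lower.
  rewrite -(leq_pmul2l (_ : 0 < k.+1 * N)%N) ?muln_gt0 //.
  by move: h1 h2; rewrite -/B; clearbody B; clear; move: (q ^ N)%N (pi_ N) => Q P; nia.
have le_S : (k * (m * S) <= m.-1 * (k.+2 * pi_ N))%N.
  have h1 := leq_mul (leqnn k) bound_S; have h2 := leq_mul (leqnn (m.-1 * k.+2)) lower.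
  rewrite -(leq_pmul2l (_ : 0 < k.+1 * N)%N) ?muln_gt0 //.
  by move: h1 h2; clearbody S; clear; move: (q ^ N)%N (pi_ N) (m.-1) => Q P m'; nia.
have h1 := leq_mul (leqnn (k * m)) pi_sum; have m_gt0 := prime_gt0 m_prime.
by move: h1 le_S; rewrite -(prednK m_gt0) /=; clearbody B S; clear; move: (pi_ N) (m.-1) => P m'; nia.
Qed.

End Counting.

(** * Families of polynomials *)

(** Orthogonality for the character of exponent vectors modulo [m] defined by [z]: its kernel is
    everything or has index [m]. The factor [m] avoids writing [m ^ (l - 1)]. *)
Lemma card_unity_exponents (F : finFieldType) (m l : nat) (z : 'I_l -> F) :
    prime m -> (forall i, z i ^+ m = 1) ->
  (m * #|[set a : {ffun 'I_l -> 'I_m} | (\prod_i z i ^+ a i == 1)%R]%SET| =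
     if [forall i, (z i == 1)%R] then m * m ^ l else m ^ l)%N.
Proof.
move=> m_prime zm; have card_all : #|{ffun 'I_l -> 'I_m}| = (m ^ l)%N.
  by rewrite card_ffun !card_ord.
case: ifP => [/forallP z1|/negbT].
  rewrite -card_all -cardsT; congr (_ * #|pred_of_set _|)%N; apply/setP=> a.
  by rewrite !inE big1 ?eqxx // => i _; rewrite (eqP (z1 i)) expr1n.
rewrite negb_forall => /existsP[i0 zi0].
have m_gt0 := prime_gt0 m_prime.
have prim_z : m.-primitive_root (z i0).
  have [k prim_k dvd_k] := prim_order_exists m_gt0 (zm i0).
  case/primeP: (m_prime) => _ /(_ k dvd_k)/pred2P[] eq_k; rewrite eq_k in prim_k => //.
  by have /eqP := prim_expr_order prim_k; rewrite expr1 (negbTE zi0).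
(* Adding [s] to the exponent of [z i0] multiplies the product by [z i0 ^+ s], so each
   value of the product is taken equally often. *)
pose shift (s : 'I_m) (a : {ffun 'I_l -> 'I_m}) : {ffun 'I_l -> 'I_m} :=
  [ffun i => if i == i0 then Ordinal (ltn_pmod (a i + s) m_gt0) else a i].
have prod_shift s a : \prod_i z i ^+ (shift s a) i = z i0 ^+ s * \prod_i z i ^+ a i.
  rewrite (bigD1 i0) //= ffunE eqxx /= -(prim_expr_mod prim_z) modn_mod.
  rewrite (prim_expr_mod prim_z) exprD [in RHS](bigD1 i0) //= mulrA [z i0 ^+ s * _]mulrC.
  by congr (_ * _); apply: eq_bigr => i /negbTE ne_i; rewrite ffunE ne_i.
have shift_inj s : injective (shift s).
  move=> a b /ffunP eq_ab; apply/ffunP => i; have := eq_ab i; rewrite !ffunE.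
  case: ifP => [/eqP->|//] /(congr1 val) /= /eqP; rewrite eqn_modDr !modn_small //.
  by move/eqP/val_inj.
have prod_unity (a : {ffun 'I_l -> 'I_m}) : (\prod_i z i ^+ a i) ^+ m = 1.
  by rewrite -prodrXl big1 // => i _; rewrite exprAC zm expr1n.
have -> : #|[set a : {ffun 'I_l -> 'I_m} | (\prod_i z i ^+ a i == 1)%R]%SET| =
    (\sum_(a : {ffun 'I_l -> 'I_m}) (\prod_i z i ^+ a i == 1)%R)%N.
  by rewrite -sum1_card big_mkcond; apply: eq_bigr => a _; rewrite inE; case: eqP.
rewrite -[X in (X * _)%N]card_ord -sum_nat_const -card_all -[RHS]sum1_card.
transitivity (\sum_(s < m) \sum_(a : {ffun 'I_l -> 'I_m}) (z i0 ^+ s * \prod_i z i ^+ a i == 1)%R)%N.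
  apply: eq_bigr => s _; rewrite (reindex_inj (@shift_inj s)) /=.
  by apply: eq_bigr => a _; rewrite prod_shift.
rewrite exchange_big; apply: eq_bigr => a _ /=.
(* Exactly one shift [s] turns the product into 1. *)
have inv_unity : (\prod_i z i ^+ a i)^-1 ^+ m = 1 by rewrite exprVn prod_unity invr1.
have [s eq_s] := prim_rootP prim_z inv_unity.
have prod_neq0 : \prod_i z i ^+ a i != 0.
  by apply: contra_eq_neq (prod_unity a) => ->; rewrite expr0n gtn_eqF // eq_sym oner_neq0.
rewrite (bigD1 s) //= -eq_s mulVf // eqxx big1 ?addn0 // => s' ne_s.
apply/eqP; rewrite eqb0; apply: contra ne_s => /eqP eq1.
have : z i0 ^+ s' == z i0 ^+ s by rewrite -eq_s; apply/eqP/(mulIf prod_neq0); rewrite eq1 mulVf.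
by rewrite (eq_prim_root_expr prim_z) !modn_small.
Qed.

Lemma cvg_sum_fin (R : realType) (I : finType) (u : I -> nat -> R) (x : I -> R) :
    (forall i, u i @ \oo --> x i)%classic ->
  ((fun N => \sum_i u i N)%R @ \oo --> (\sum_i x i)%R)%classic.
Proof.
move=> lim_u; elim: (index_enum I) => [|i s IHs].
  rewrite big_nil; under eq_fun do rewrite big_nil; exact: cvg_cst.
rewrite big_cons; under eq_fun do rewrite big_cons.
exact: cvgD (lim_u i) IHs.
Qed.

Section KummerFamily.

Variables (F : finFieldType) (m : nat) (m_prime : prime m) (m_dvd : (m %| #|F| - 1)%N).
Variables (l : nat) (D : 'I_l -> {poly F}).
Hypothesis D_neq0 : forall i, D i != 0.

Let Dexp (a : {ffun 'I_l -> 'I_m}) : {poly F} := \prod_(i < l) D i ^+ a i.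
Local Notation pi_ := (count_degree (@monic_irreducible F)).

Section Prime.

Variable P : {poly F}.
Hypotheses (mP : P \is monic) (iP : irreducible_poly P).
Hypothesis ndvdP : forall i, ~~ (P %| D i).

Lemma residue_class_prodE (a : {ffun 'I_l -> 'I_m}) :
  residue_class m (Dexp a) 1 P <-> \prod_i residue_symbol m (D i) P ^+ a i = 1.
Proof.
set n := ((#|F| ^ (size P).-1 - 1) %/ m)%N.
have dvd_prod : P %| Dexp a ^+ n - (\prod_i residue_symbol m (D i) P ^+ a i)%:P.
  rewrite rmorph_prod -prodrXl /=.
  elim/big_rec2: _ => [|i u v _ IH]; first by rewrite subrr dvdp0.
  have [_ dvdc] := (residue_symbolP _ m_dvd mP iP (ndvdP i)).1 erefl.
  rewrite -/n in dvdc; rewrite exprAC rmorphXn /=.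
  set x := _ ^+ n in dvdc *; set y := _%:P in dvdc *.
  have -> : x ^+ a i * v - y ^+ a i * u = x ^+ a i * (v - u) + (x ^+ a i - y ^+ a i) * u by ring.
  by apply: dvdp_add; [apply: dvdp_mull|rewrite subrXX -mulrA dvdp_mulr].
set c := \prod_i _ in dvd_prod *; split=> [[_]|c1]; last first.
  by split; [split|rewrite -/n -c1].
rewrite -/n => dvd1; have : P %| (c - 1)%:P.
  have -> : (c - 1)%:P = (Dexp a ^+ n - 1%:P) - (Dexp a ^+ n - c%:P) by rewrite polyCB; ring.
  by rewrite dvdp_sub.
by move/(irred_dvdp_polyC iP)/eqP; rewrite subr_eq0 => /eqP.
Qed.

(** The power in question is [G ^+ (m * n)] with [m * n] the order of the unit group modulo [P]. *)
Lemma residue_class_pow (a : {ffun 'I_l -> 'I_m}) (G : {poly F}) :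
  Dexp a = G ^+ m -> residue_class m (Dexp a) 1 P.
Proof.
move=> eq_G; split; first by split.
have ndvdG : ~~ (P %| G).
  apply/negP => dvdG; have : P %| Dexp a.
    by rewrite eq_G -(prednK (prime_gt0 m_prime)) exprS dvdp_mulr.
  case/(dvdp_bigprod iP)/hasP => i _; apply/negP.
  elim: (a i : nat) => [|k IHk]; first by rewrite dvdp1 gtn_eqF // irred_size_gt1.
  by rewrite exprS Gauss_dvdpr // irreducible_poly_coprime.
have := dvdp_Frobenius G (dvdp_irred_Xcard mP iP).
rewrite -[X in G ^+ X - G](mul_divn_card m_dvd) exprS exprM eq_G.
have -> u : G * u - G = G * (u - 1) by rewrite mulrBr mulr1.
by rewrite polyC1 Gauss_dvdpr ?irreducible_poly_coprime.
Qed.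

(** The term [m ^ l] times the indicator is on both sides to avoid a subtraction: the count is
    [m ^ l / m] unless [P] splits. *)
Lemma card_residue_class :
  (m * #|[set a : {ffun 'I_l -> 'I_m} | `[< residue_class m (Dexp a) 1%R P >]]%SET| +
    m ^ l * `[< split_primes m D P >] =
    m ^ l + m * m ^ l * `[< split_primes m D P >])%N.
Proof.
have -> : [set a | `[< residue_class m (Dexp a) 1%R P >]]%SET =
    [set a : {ffun 'I_l -> 'I_m} | (\prod_i residue_symbol m (D i) P ^+ a i == 1)%R]%SET.
  apply/setP => a; rewrite !inE; apply/asboolP/eqP; by rewrite residue_class_prodE.
rewrite card_unity_exponents // => [|i]; last exact: residue_symbol_unity.
have -> : `[< split_primes m D P >] = [forall i, residue_symbol m (D i) P == 1].
  apply/asboolP/forallP => [[_ sym1] i|sym1]; first exact/eqP.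
  by split; [split|move=> i; exact/eqP].
by case: ifP => _; rewrite ?muln1 ?muln0 ?addn0 // addnC.
Qed.

End Prime.

Lemma sum_count_residue_class (N : nat) : (forall i, (size (D i) <= N)%N) ->
  (m * (\sum_(a : {ffun 'I_l -> 'I_m}) count_degree (residue_class m (Dexp a) 1%R) N) +
    m ^ l * count_degree (split_primes m D) N =
    m ^ l * pi_ N + m * m ^ l * count_degree (split_primes m D) N)%N.
Proof.
move=> le_N.
have countE (T : set {poly F}) : (T `<=` @monic_irreducible F)%classic ->
    count_degree T N = (\sum_(P : {poly_N.+1 F} |
      (size P == N.+1) && `[< monic_irreducible P >]) `[< T P >])%N.
  move=> subT; rewrite /count_degree -sum1_card big_mkcond [RHS]big_mkcond /=.
  apply: eq_bigr => P _; rewrite inE; case: (size P == _) => //=.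
  case: (asboolP (T P)) => [/subT iP|_]; last by case: ifP.
  by case: asboolP.
have rc_sub a : (residue_class m (Dexp a) 1 `<=` @monic_irreducible F)%classic by move=> P [].
under eq_bigr => a _ do rewrite (countE _ (rc_sub a)).
rewrite exchange_big /= !countE //; last by move=> P [].
rewrite !big_distrr /= -!big_split /=; apply: eq_bigr => P.
case/andP=> /eqP szP /asboolP irrP; case: (irrP) => mP iP.
have ndvdP i : ~~ (P %| D i).
  by apply/negP => /(dvdp_leq (D_neq0 i)); rewrite szP => /leq_trans/(_ (le_N i)); rewrite ltnn.
rewrite (asboolT irrP) muln1 -card_residue_class // -sum1_card [in RHS]big_mkcond /=.
by congr (_ * _ + _)%N; apply: eq_bigr => a _; rewrite inE; case: asboolP.
Qed.

(** * Passage from counts to densities *)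

Section Limits.

Variable R : realType.

Lemma pi_eventually_gt0 : exists N0, forall N, (N0 <= N)%N -> (0 < pi_ N)%N.
Proof.
have [N0 lower] := pi_lower F 2; exists N0 => N /lower; case: (pi_ N) => //.
have : (0 < #|F| ^ N)%N by rewrite expn_gt0 ltnW ?card_finField_gt1.
by rewrite !muln0; lia.
Qed.

Lemma residue_class_density (E : {poly F}) : E != 0 ->
    (forall (c : F) (G : {poly F}), E != c *: G ^+ m) ->
  has_relative_density (residue_class m E 1) (m%:R^-1 : R).
Proof.
move=> E_neq0 not_pow; apply/cvgrPdist_le => e e_gt0.
(* The deviation from [1/m] is at most [2/(k*m)] above and [2/k] below. *)
pose k := (Num.truncn (2 / e)).+1.
have k_gt0 : (0 : R) < k%:R by rewrite ltr0n.
have le_k : 2 / k%:R <= e.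
  rewrite ler_pdivrMr // mulrC -ler_pdivrMr //; apply/ltW/truncnS_gt.
have [N0 equi] := residue_class_equidistributed m_prime m_dvd k E_neq0 not_pow.
exists N0 => // N /= /equi; set B := count_degree _ N; set p := pi_ N => -[p_gt0].
have m_gt0 : (0 : R) < m%:R by rewrite ltr0n prime_gt0.
have {p_gt0} p_gt0 : (0 : R) < p%:R by rewrite ltr0n.
rewrite -!(ler_nat R) !(natrM, natrD) -addn2 natrD => upper lower.
apply: le_trans le_k; rewrite ler_norml.
have m_ge1 : (1 : R) <= m%:R by rewrite ler1n prime_gt0.
set x : R := B%:R / p%:R.
have def_B : B%:R = x * p%:R :> R by rewrite /x mulfVK // gt_eqF.
have {}upper : k%:R * m%:R * x <= k%:R + 2.
  by rewrite -(ler_pM2r p_gt0); move: upper; rewrite def_B; lra.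
have {}lower : k%:R <= k%:R * m%:R * x + 2 * m%:R.
  by rewrite -(ler_pM2r p_gt0); move: lower; rewrite def_B; lra.
have km_gt0 : (0 : R) < k%:R * m%:R by rewrite mulr_gt0.
have k_neq0 : k%:R != 0 :> R by rewrite gt_eqF.
have m_neq0 : m%:R != 0 :> R by rewrite gt_eqF.
have eq_k : k%:R * m%:R * (2 / k%:R) = 2 * m%:R :> R by field.
have eq_m : k%:R * m%:R * m%:R^-1 = k%:R :> R by field.
by apply/andP; split; rewrite -(ler_pM2l km_gt0) ?mulrN mulrBr eq_k eq_m; lra.
Qed.

Lemma split_primes_density :
    (forall (a : {ffun 'I_l -> 'I_m}) (c : F) (G : {poly F}),
      Dexp a = c *: G ^+ m -> exists G', Dexp a = G' ^+ m) ->
  has_relative_density (split_primes m D) ((gamma_set m D)%:R / (m ^ l)%N%:R : R).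
Proof.
move=> geom; have Dexp_neq0 a : Dexp a != 0.
  by apply/prodf_neq0 => i _; rewrite expf_neq0.
pose gam := [set a : {ffun 'I_l -> 'I_m} | `[< exists G, Dexp a = G ^+ m >]]%SET.
have [N0 pi_gt0] := pi_eventually_gt0.
pose N1 := (N0 + \sum_i size (D i))%N.
have large N : (N1 <= N)%N -> (0 < pi_ N)%N /\ forall i, (size (D i) <= N)%N.
  move=> le_N; split=> [|i]; first by apply: pi_gt0; apply: leq_trans le_N; apply: leq_addr.
  apply: leq_trans le_N; rewrite /N1 (bigD1 i) //=; lia.
have lim_a (a : {ffun 'I_l -> 'I_m}) :
    has_relative_density (residue_class m (Dexp a) 1) (if a \in gam then 1 else m%:R^-1 : R).
  rewrite inE; case: asboolP => [[G eq_G]|not_pow]; last first.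
    apply: residue_class_density => // c G; apply/eqP => /geom; exact: not_pow.
  rewrite /has_relative_density; apply: cvg_near_cst; exists N1 => // N /= /large[pi_N_gt0 le_N].
  have -> : count_degree (residue_class m (Dexp a) 1) N = pi_ N.
    apply: eq_card => P; rewrite !inE; have [szP|//] := eqVneq (size P) N.+1.
    apply/asboolP/asboolP => [[]//|[mP iP]]; apply: (residue_class_pow mP iP _ eq_G) => i.
    by apply/negP => /(dvdp_leq (D_neq0 i)); rewrite szP => /leq_trans/(_ (le_N i)); rewrite ltnn.
  by rewrite divff // pnatr_eq0 -lt0n.
have m_gt1 : (1 : R) < m%:R by rewrite ltr1n prime_gt1.
have ml_gt0 : (0 : R) < (m ^ l)%N%:R by rewrite ltr0n expn_gt0 prime_gt0.
pose S N := \sum_(a : {ffun 'I_l -> 'I_m})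
  ((count_degree (residue_class m (Dexp a) 1) N)%:R / (pi_ N)%:R : R).
have lim_S : (S @ \oo --> (\sum_(a : {ffun 'I_l -> 'I_m}) (if a \in gam then 1 else m%:R^-1 : R))%R)%classic.
  by apply: cvg_sum_fin => a; apply: lim_a.
have sum_lim : \sum_(a : {ffun 'I_l -> 'I_m}) (if a \in gam then 1 else m%:R^-1 : R) =
    (gamma_set m D)%:R + ((m ^ l)%N%:R - (gamma_set m D)%:R) / m%:R.
  have card_all : (#|gam| + #|~: gam| = m ^ l)%N by rewrite cardsC card_ffun !card_ord.
  rewrite (bigID (mem gam)) /= (eq_bigr (fun=> 1)) => [|a ->//].
  rewrite sumr_const [X in _ + X](eq_bigr (fun=> m%:R^-1)) => [|a /negbTE ->//].
  rewrite sumr_const -card_all natrD addrAC subrr add0r mulr_natl.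
  congr (_ + _ *+ _); by apply: eq_card => a; rewrite !inE unfold_in /= inE.
(* [sum_count_residue_class] solved for the proportion of split primes; [m - 1] is nonzero as [m] is
   prime. *)
have def_split : \forall N \near \oo%classic, (m%:R * S N - (m ^ l)%N%:R) / ((m%:R - 1) * (m ^ l)%N%:R) =
    (count_degree (split_primes m D) N)%:R / (pi_ N)%:R :> R.
  exists N1 => // N /= /large[pi_N_gt0 le_N].
  have := sum_count_residue_class le_N => /(congr1 (fun n => n%:R : R)).
  rewrite !(natrD, natrM) natr_sum /S -mulr_suml.
  set s := \sum_a _; set T := (count_degree (split_primes m D) N)%:R; set p := (pi_ N)%:R => eq_s.
  have p_neq0 : p != 0 :> R by rewrite pnatr_eq0 -lt0n.
  have ml_neq0 : (m ^ l)%N%:R != 0 :> R by rewrite gt_eqF.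
  have m1_neq0 : m%:R - 1 != 0 :> R by rewrite subr_eq0 gt_eqF.
  have m_neq0 : m%:R != 0 :> R by rewrite gt_eqF // (lt_trans ltr01).
  have {eq_s} -> : s = m%:R^-1 * ((m ^ l)%N%:R * p + (m%:R - 1) * (m ^ l)%N%:R * T).
    by apply: (mulfI m_neq0); rewrite mulVKf //; move: eq_s; lra.
  by field; rewrite p_neq0 ml_neq0 m1_neq0.
apply: (cvg_trans (near_eq_cvg def_split)).
(* In the limit the numerator becomes [(m - 1)] times [gamma_set m D]. *)
have -> : (gamma_set m D)%:R / (m ^ l)%N%:R =
  (m%:R * ((gamma_set m D)%:R + ((m ^ l)%N%:R - (gamma_set m D)%:R) / m%:R) - (m ^ l)%N%:R) /
    ((m%:R - 1) * (m ^ l)%N%:R) :> R.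
  by field; rewrite !gt_eqF ?subr_gt0 // (lt_trans ltr01).
rewrite -sum_lim; apply: cvgM; last exact: cvg_cst.
by apply: cvgB; [apply: cvgM; first exact: cvg_cst|exact: cvg_cst].
Qed.

End Limits.

End KummerFamily.

(* If [\prod_i D i ^+ a i = c *: G ^+ m], the element [\prod_i r i ^+ a i / G] of [K]
   is an [m]-th root of the constant [c]. *)
Lemma geometric_prod_pow (F : finFieldType) (m l : nat) (D : 'I_l -> {poly F})
    (K : fieldExtType {fraction {poly F}}) (r : 'I_l -> K)
    (a : 'I_l -> nat) (c : F) (G : {poly F}) :
    (0 < m)%N -> (forall i, r i ^+ m = (FracField.tofrac (D i))%:A) ->
    geometric_extension K -> \prod_i D i ^+ a i = c *: G ^+ m ->
  exists G', \prod_i D i ^+ a i = G' ^+ m.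
Proof.
move=> m_gt0 r_root geomK eq_G.
have [G0|G_neq0] := eqVneq G 0.
  by exists 0; rewrite eq_G G0 expr0n gtn_eqF // scaler0.
pose emb : {rmorphism {poly F} -> K} := in_alg K \o (@FracField.tofrac {poly F}).
have embE u : emb u = (FracField.tofrac u)%:A by [].
have embG_neq0 : emb G != 0 by rewrite fmorph_eq0 tofrac_eq0.
pose x : K := \prod_i r i ^+ a i / emb G.
have xm : x ^+ m = constant_embedding K c.
  rewrite /x expr_div_n -prodrXl.
  under eq_bigr => i _ do rewrite exprAC r_root -embE -rmorphXn.
  rewrite -rmorph_prod eq_G -mul_polyC rmorphM rmorphXn /= mulfK ?expf_neq0 //.
(* As a root of ['X^m - c%:P], the element [x] is algebraic over the constants, hence a constant
   [c'] with [c' ^+ m = c]; the factor [c] is then absorbed into [G]. *)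
have [|c' eq_x] := geomK x.
  exists ('X^m - c%:P); first by rewrite -size_poly_eq0 size_XnsubC.
  rewrite (eq_map_poly (g := emb \o polyC)) // rmorphB /= map_polyXn map_polyC /=.
  by rewrite rootE !hornerE xm subrr.
exists (c' *: G); rewrite eq_G exprZn; congr (_ *: _).
apply/esym/(@fmorph_inj _ _ (emb \o polyC)).
by rewrite rmorphXn; rewrite -[LHS]/(constant_embedding K c' ^+ m) -eq_x xm.
Qed.

Theorem theorem2p5 (R : realType) (F : finFieldType) (m : nat)
    (m_prime : prime m) (m_dvd : (m %| #|F| - 1)%N)
    (l : nat) (D : 'I_l -> {poly F})
    (D_inj : injective D)
    (D_nonconst : forall i : 'I_l, (1 < size (D i))%N)
    (K : fieldExtType {fraction {poly F}}) (r : 'I_l -> K)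
    (r_root : forall i : 'I_l, r i ^+ m = (FracField.tofrac (D i))%:A)
    (K_gen : (<<1%VS & [seq r i | i <- enum 'I_l]>> = fullv)%VS)
    (K_geom : geometric_extension K) :
  has_relative_density (split_primes m D)
    ((gamma_set m D)%:R / (m ^ l)%N%:R : R).
Proof.
apply: split_primes_density => // [i|a c G].
  by rewrite -size_poly_gt0 ltnW.
exact: geometric_prod_pow (prime_gt0 m_prime) r_root K_geom.
Qed.
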